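(* Assume complete randomization and that $V_{\hat\gamma}$ is nonsingular. There is a universal constant $C>0$ such that: (i) for every $b\in\mathbb R^H$ with $\|b\|_2=1$, $$\sup_{t\in\mathbb R}\big|\mathbb P\{b^\top\tilde\gamma\le t\}-\Phi(t)\big|\le C\,\big\|b^\top V_{\hat\gamma}^{-1/2}F^\top\big\|_\infty\cdot\max_{q\in[Q]}N_q^{-1}M_N(q),$$ where $\|x\|_\infty=\max_k|x_k|$ for a row vector $x$; (ii) if moreover Condition 1 holds with constant $\sigma_F$, then $$\sup_{b\in\mathbb R^H,\|b\|_2=1}\ \sup_{t\in\mathbb R}\big|\mathbb P\{b^\top\tilde\gamma\le t\}-\Phi(t)\big|\le C\max_{i\in[N],q\in[Q]}\min\{\mathrm I(i,q),\mathrm{II}(i,q)\},$$ where $\mathrm I(i,q)=\sigma_F\,\dfrac{|Y_i(q)-\overline Y(q)|}{\sqrt{N_qS(q,q)}}$ and $\mathrm{II}(i,q)=\dfrac{\|F(q,\cdot)\|_2\,N_q^{-1}|Y_i(q)-\overline Y(q)|}{\sqrt{\varrho_{\min}(F^\top V_{\hat Y}F)}}$.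
   Context: Randomization model: there are $N$ units and $Q$ treatment levels with prescribed group sizes $N_1,\dots,N_Q\ge1$, $\sum_{q=1}^QN_q=N$. Each unit $i\in[N]=\{1,\dots,N\}$ has fixed (non-random) real potential outcomes $Y_i(1),\dots,Y_i(Q)$. Under complete randomization the treatment vector $Z=(Z_1,\dots,Z_N)$ is uniformly distributed over all vectors in $[Q]^N$ having exactly $N_q$ coordinates equal to $q$ for each $q$; the observed outcome is $Y_i=Y_i(Z_i)$. Write $\overline Y(q)=N^{-1}\sum_iY_i(q)$, $\overline Y=(\overline Y(1),\dots,\overline Y(Q))^\top$, $S(q,q')=(N-1)^{-1}\sum_i(Y_i(q)-\overline Y(q))(Y_i(q')-\overline Y(q'))$, $S=(S(q,q'))_{q,q'\in[Q]}$, $\hat Y_q=N_q^{-1}\sum_{i:Z_i=q}Y_i$, $\hat Y=(\hat Y_1,\dots,\hat Y_Q)^\top$, and $V_{\hat Y}=\mathrm{diag}(N_q^{-1}S(q,q))_{q\in[Q]}-N^{-1}S$ (the covariance matrix of $\hat Y$). For a fixed matrix $F=(f_{qh})\in\mathbb R^{Q\times H}$ with rows $F(q,\cdot)$, let $\gamma=F^\top\overline Y$, $\hat\gamma=F^\top\hat Y$, $V_{\hat\gamma}=F^\top V_{\hat Y}F$ (assumed nonsingular) and $\tilde\gamma=V_{\hat\gamma}^{-1/2}(\hat\gamma-\gamma)$. Let $M_N(q)=\max_{i\in[N]}|Y_i(q)-\overline Y(q)|$, $\|F\|_\infty=\max_{q,h}|f_{qh}|$, $\varrho_{\min}(\cdot)$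 the smallest eigenvalue of a symmetric matrix, and $\Phi$ the standard normal cdf. Condition 1: there exists $\sigma_F\ge1$ such that $F^\top\mathrm{diag}(N_q^{-1}S(q,q))_{q\in[Q]}F\preceq\sigma_F^2F^\top V_{\hat Y}F$ in the Loewner order. *)

(* Defs.v *)
From HB Require Import structures.
From mathcomp Require Import all_boot all_order all_algebra.
From mathcomp Require Import all_classical all_reals all_analysis.
From mathcomp Require Import normal_distribution.
From mathcomp Require Import Rstruct Rstruct_topology.
Set Implicit Arguments. Unset Strict Implicit. Unset Printing Implicit Defensive.
Import Order.TTheory GRing.Theory Num.Theory.
Local Open Scope ring_scope.

Section CRE.
Variable R : realType.
(* N units, Q treatment levels, H contrasts *)
Variables (N Q : nat).
Variable Nq : 'I_Q -> nat.
Variable Y : 'I_N -> 'I_Q -> R.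

Definition assignment := {ffun 'I_N -> 'I_Q}.

Definition CR_support : {set assignment} :=
  [set z : assignment | [forall q : 'I_Q, #|[set i | z i == q]| == Nq q]].

Definition CR_prob (E : assignment -> bool) : R :=
  #|[set z in CR_support | E z]|%:R / #|CR_support|%:R.

Definition Ybar (q : 'I_Q) : R := N%:R^-1 * \sum_(i < N) Y i q.
Definition Ybar_vec : 'cV[R]_Q := \col_q Ybar q.

Definition Scov (q q' : 'I_Q) : R :=
  (N.-1)%:R^-1 * \sum_(i < N) (Y i q - Ybar q) * (Y i q' - Ybar q').

(* hat Y_q for assignment z (observed outcome of i is Y i (z i)) *)
Definition Yhat (z : assignment) : 'cV[R]_Q :=
  \col_q ((Nq q)%:R^-1 * \sum_(i < N | z i == q) Y i (z i)).

Definition Dmat : 'M[R]_Q := \matrix_(q, q') ((q == q')%:R * (Scov q q / (Nq q)%:R)).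
Definition V_Yhat : 'M[R]_Q := Dmat - \matrix_(q, q') (Scov q q' / N%:R).

Definition M_N (q : 'I_Q) : R := \big[Num.max/0]_(i < N) `|Y i q - Ybar q|.
End CRE.
Arguments CR_prob {R N Q} Nq E.

Section Linalg.
Variable R : realType.
Definition psd n (A : 'M[R]_n) : Prop := forall x : 'cV[R]_n, 0 <= (x^T *m A *m x) 0 0.
Definition loewner_le n (A B : 'M[R]_n) : Prop := psd (B - A).

Definition posdef n (A : 'M[R]_n) : Prop :=
  forall x : 'cV[R]_n, x != 0 -> 0 < (x^T *m A *m x) 0 0.

Definition is_inv_sqrt n (W V : 'M[R]_n) : Prop :=
  W^T = W /\ posdef W /\ W *m W *m V = 1%:M.

Definition rho_min n (A : 'M[R]_n) : R := inf [set a : R | eigenvalue A a].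

Definition norm2_col n (x : 'cV[R]_n) : R := Num.sqrt (\sum_i x i 0 ^+ 2).
Definition norminf_row n (x : 'rV[R]_n) : R := \big[Num.max/0]_i `|x 0 i|.

Definition Phi (t : R) : R := fine (normal_prob 0 1 `]-oo, t]%classic).
End Linalg.

(* Main.v *)
(** With [c = b^T W F^T], the statistic [b^T gtilde] is [\sum_i A i (z i)] for
    [A i q = c_q / N_q * (Y i q - Ybar q)]; since [z] is a fixed assignment composed
    with a uniform permutation [s], it is a combinatorial sum [\sum_i a i (s i)] with
    [a] doubly centered and unit variance.  The Berry-Esseen bound is obtained by
    Stein's method with a bounded zero-bias coupling (Goldstein): the exchangeable
    pair given by a random transposition yields
    [E (S g(S)) = E ((g(S1) - g(S2)) / (S1 - S2))], where [S1] and [S2] are within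
    [12 * max |a|] of [S].  Applied to the solution [g] of the Stein equation, this
    gives an error of order [max |a|], hence of order [max |A|].  Part (i) bounds
    [max |A|] directly.  Part (ii) bounds [c_q] by Condition 1 and by Cauchy-Schwarz
    together with [rho_min |W b|^2 <= (W b)^T V (W b) = 1]. *)

Require Import Defs.
From HB Require Import structures.
From mathcomp Require Import all_boot all_order all_fingroup all_algebra.
From mathcomp Require Import all_classical all_reals all_analysis.
From mathcomp Require Import normal_distribution.
From mathcomp Require Import Rstruct Rstruct_topology.
From mathcomp Require Import ring lra.
Import Order.TTheory GRing.Theory Num.Theory.
Import numFieldNormedType.Exports.
Local Open Scope ring_scope.
Set Implicit Arguments. Unset Strict Implicit. Unset Printing Implicit Defensive.

(** * The Stein equation for the normal distribution *)

Section Gaussian.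
Local Open Scope classical_set_scope.
Local Open Scope ring_scope.
Context {R : realType}.
Implicit Types (x w z a b d m M : R).

Lemma mean_value_bounds (f df : R -> R) a b m M : a <= b ->
  (forall x, is_derive x 1 f (df x)) ->
  (forall x, a < x < b -> m <= df x <= M) ->
  m * (b - a) <= f b - f a <= M * (b - a).
Proof.
rewrite le_eqVlt => /predU1P[-> _ _|ab fdf dfmM]; first by rewrite !subrr !mulr0 lexx.
have [|c cab ->] := @MVT _ f df a b ab (fun x _ => fdf x).
  apply: continuous_subspaceT => x.
  by apply/differentiable_continuous/derivable1_diffP; case: (fdf x).
have /dfmM/andP[mc cM] : a < c < b by rewrite !(itvP cab).
by apply/andP; split; apply: ler_wpM2r => //; rewrite subr_ge0 ltW.
Qed.

Local Notation phi := (@normal_pdf R 0 1).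
Local Notation Phi := (@Phi R).

Lemma std_normal_pdfE x : phi x = normal_peak 1 * expR (- x ^+ 2 / 2).
Proof. by rewrite normal_pdfE ?oner_neq0// /normal_fun subr0 expr1n. Qed.

Lemma std_normal_pdf_gt0 x : 0 < phi x.
Proof.
by rewrite std_normal_pdfE mulr_gt0 ?expR_gt0// normal_peak_gt0// oner_neq0.
Qed.

Lemma std_normal_pdf_le1 x : phi x <= 1.
Proof.
apply: (le_trans (normal_pdf_ub _ _ (oner_neq0 _))).
rewrite /normal_peak invf_le1 ?sqrtr_gt0; last first.
  by rewrite expr1n mul1r mulrn_wgt0 ?pi_gt0.
rewrite -[leLHS]sqrtr1 ler_wsqrtr// expr1n mul1r.
by have := pi_ge2 R; lra.
Qed.

Lemma std_normal_pdfN x : phi (- x) = phi x.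
Proof. by rewrite !std_normal_pdfE sqrrN. Qed.

Lemma is_derive_std_normal_pdf x : is_derive x 1 phi (- x * phi x).
Proof.
have -> : phi = normal_peak 1 \*: (expR \o (fun y => - (2^-1 : R) *: y ^+ 2)).
  apply/funext => y /=; rewrite std_normal_pdfE; congr (_ * expR _).
  by rewrite /GRing.scale /=; ring.
have D : is_derive x 1 (fun y : R => - (2^-1 : R) *: y ^+ 2) (- x).
  apply: is_derive_eq; by rewrite /GRing.scale /=; field.
apply: is_derive_eq.
by rewrite /= /GRing.scale /=; ring.
Qed.

Lemma is_derive_Phi x : is_derive x 1 Phi (phi x).
Proof.
have xx1 : x < x + 1 by rewrite ltrDl.
have int1 : lebesgue_measure.-integrable
    [set` Interval -oo%O (BRight (x + 1))] (EFin \o phi).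
  by apply: (integrableS measurableT) => //; exact: integrable_normal_pdf.
have [d1 d2] := continuous_FTC1 xx1 int1 (ltNyr _)
  (@continuous_normal_pdf R 0 1 (oner_neq0 _) x).
split; first exact: d1.
by rewrite -derive1E; exact: d2.
Qed.

Lemma Phi_ge0 x : 0 <= Phi x.
Proof. by rewrite fine_ge0. Qed.

Lemma Phi_le1 x : Phi x <= 1.
Proof.
rewrite -lee_fin fineK; first exact: (@probability_le1 _ _ _ (normal_prob 0 1)).
exact: (@fin_num_measure _ _ _ (normal_prob 0 1)).
Qed.

(** The identity seen as a random variable under [normal_prob 0 1]. Its cdf is [Phi], so the general
    limits of cdfs apply to [Phi]. *)
Let idTR : measurableTypeR R -> R := idfun.

#[local] HB.instance Definition _ :=
  @isMeasurableFun.Build _ _ _ _ idTR (@measurable_id _ _ setT).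

Lemma cvg_Phi_pinfty : Phi x @[x --> +oo] --> (1 : R).
Proof.
have := @cvg_cdfy1 _ _ _ (normal_prob 0 1) (idTR : {RV (normal_prob 0 1) >-> R}).
by move/fine_cvg; exact.
Qed.

Lemma cvg_Phi_ninfty : Phi x @[x --> -oo] --> (0 : R).
Proof.
have := @cvg_cdfNy0 _ _ _ (normal_prob 0 1) (idTR : {RV (normal_prob 0 1) >-> R}).
by move/fine_cvg; exact.
Qed.

(* On [t >= w] the function [w * G t + phi t] has derivative [(w - t) * phi t <= 0]. *)
Lemma mills_ratio_le (G : R -> R) w : 0 < w ->
  (forall x, is_derive x 1 G (phi x)) -> G x @[x --> +oo] --> (1 : R) ->
  w * (1 - G w) <= phi w.
Proof.
move=> w0 dG Gy.
have incG x : w <= x -> w * (G x - G w) <= phi w.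
  move=> wx.
  have D (y : R) : is_derive y 1 (fun t : R => w *: G t + phi t) (w * phi y - y * phi y).
    have := dG y; have := is_derive_std_normal_pdf y => d1 d2.
    by apply: is_derive_eq; rewrite /GRing.scale/= mulNr.
  have B (y : R) : w < y < x -> w - x <= w * phi y - y * phi y <= 0.
    move=> /andP[wy yx].
    have := std_normal_pdf_gt0 y; have := std_normal_pdf_le1 y; nra.
  have /andP[_] := mean_value_bounds wx D B.
  rewrite mul0r /GRing.scale/= mulrBr; have := std_normal_pdf_gt0 x; lra.
have : (w * (G x - G w)) @[x --> +oo] --> w * (1 - G w).
  by apply: cvgMr; apply: cvgB => //; exact: cvg_cst.
move=> /cvgr_to_le; apply.
by near=> x; apply: incG; near: x; apply: nbhs_pinfty_ge; rewrite num_real.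
Unshelve. all: by end_near. Qed.

Lemma mills_Phi_right w : 0 < w -> w * (1 - Phi w) <= phi w.
Proof.
by move=> w0; apply: mills_ratio_le => //; [exact: is_derive_Phi|exact: cvg_Phi_pinfty].
Qed.

(** The reflection [x |-> 1 - Phi (- x)] is another primitive of [phi] tending to 1 at [+oo];
    [mills_ratio_le] is stated for a general [G] to cover it. *)
Lemma mills_Phi_left w : w < 0 -> - w * Phi w <= phi w.
Proof.
move=> w0; rewrite -{2}[w]opprK -[Phi _](subKr 1) -std_normal_pdfN.
apply: (@mills_ratio_le (fun x => 1 - Phi (- x))); first by rewrite oppr_gt0.
  move=> x; rewrite -std_normal_pdfN.
  have D : is_derive x 1 (Phi \o -%R) (phi (- x) * (- 1)).
    by apply: is_derive1_comp; exact: is_derive_Phi.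
  have -> : (fun y => 1 - Phi (- y)) = cst 1 - (Phi \o -%R) by [].
  by apply: is_derive_eq; rewrite sub0r mulrN1 opprK.
rewrite -[X in _ --> X](subr0 1).
apply: cvgB; first exact: cvg_cst.
have := cvg_Phi_ninfty; rewrite cvgNy_compNP; exact.
Qed.

Lemma is_derive_Phi_div_pdf x :
  is_derive x 1 (fun y => Phi y / phi y) (1 + x * (Phi x / phi x)).
Proof.
have p0 : phi x != 0 by rewrite gt_eqF// std_normal_pdf_gt0.
have D1 := is_derive_Phi x; have D2 := is_derive_std_normal_pdf x.
have D3 := is_deriveV p0 D2.
have -> : (fun y => Phi y / phi y) = Phi * (fun y => (phi y)^-1) by [].
by apply: is_derive_eq; rewrite /GRing.scale/=; field.
Qed.

Lemma is_derive_Phic_div_pdf x : is_derive x 1 (fun y => (1 - Phi y) / phi y)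
  (x * ((1 - Phi x) / phi x) - 1).
Proof.
have p0 : phi x != 0 by rewrite gt_eqF// std_normal_pdf_gt0.
have D1 := is_derive_Phi x; have D2 := is_derive_std_normal_pdf x.
have D3 := is_deriveV p0 D2.
have -> : (fun y => (1 - Phi y) / phi y) = (cst 1 - Phi) * (fun y => (phi y)^-1) by [].
by apply: is_derive_eq; rewrite /GRing.scale/= !fctE/=; field.
Qed.

Lemma Phi_increment a b : a <= b -> 0 <= Phi b - Phi a <= b - a.
Proof.
move=> ab; rewrite -(mul0r (b - a)) -[X in _ <= _ <= X]mul1r.
apply: (mean_value_bounds ab is_derive_Phi) => x _.
by rewrite ltW ?std_normal_pdf_gt0// std_normal_pdf_le1.
Qed.

(** The bounded solution [f] of the Stein equation [f' w - w * f w = (w <= z)%:R - Phi z], made of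
    two smooth branches glued at [w = z]. *)
Definition stein_sol z w : R :=
  if w <= z then Phi w * (1 - Phi z) / phi w else Phi z * (1 - Phi w) / phi w.

Lemma stein_sol_leE z w : w <= z -> stein_sol z w = (1 - Phi z) * (Phi w / phi w).
Proof. by rewrite /stein_sol => ->; rewrite mulrCA mulrA. Qed.

Lemma stein_sol_geE z w : z <= w -> stein_sol z w = Phi z * ((1 - Phi w) / phi w).
Proof.
rewrite /stein_sol le_eqVlt => /predU1P[->|zw]; first by rewrite lexx mulrA.
by rewrite leNgt zw /= mulrA.
Qed.

Definition stein_bound : R := 1 + (phi 1)^-1.

Lemma stein_bound_ge0 : 0 <= stein_bound.
Proof. by rewrite addr_ge0// invr_ge0 ltW// std_normal_pdf_gt0. Qed.

(** The product is [Phi (min w z) * (1 - Phi (max w z))], so the bounds follow from monotonicity of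
    [Phi]. *)
Lemma stein_sol_mul_pdf z w :
  [/\ 0 <= stein_sol z w * phi w, stein_sol z w * phi w <= Phi w
    & stein_sol z w * phi w <= 1 - Phi w].
Proof.
have p0 : phi w != 0 by rewrite gt_eqF// std_normal_pdf_gt0.
have := Phi_ge0 w; have := Phi_le1 w; have := Phi_ge0 z; have := Phi_le1 z.
rewrite /stein_sol; case: ifPn => [wz|]; last rewrite -ltNge => zw.
  have /andP[+ _] := Phi_increment wz; rewrite divfK// => *; split; nra.
have /andP[+ _] := Phi_increment (ltW zw); rewrite divfK// => *; split; nra.
Qed.

Lemma stein_sol_ge0 z w : 0 <= stein_sol z w.
Proof.
by have [+ _ _] := stein_sol_mul_pdf z w; rewrite pmulr_lge0// std_normal_pdf_gt0.
Qed.

(** After multiplication by [phi w], bound by [Phi w] for [w < 0] and by [1 - Phi w] for [w > 0],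
    and apply the Mills inequality of that side. *)
Lemma normr_mul_stein_sol z w : `|w * stein_sol z w| <= 1.
Proof.
have p0 := std_normal_pdf_gt0 w; have [f0 f1 f2] := stein_sol_mul_pdf z w.
set F := stein_sol z w * phi w in f0 f1 f2.
suff : `|w * F| <= phi w.
  by rewrite mulrA normrM (gtr0_norm p0) -{2}[phi w]mul1r ler_pM2r.
rewrite ler_norml; have [w0|w0|->] := ltgtP w 0.
- have := mills_Phi_left w0; nra.
- have := mills_Phi_right w0; nra.
- by rewrite mul0r oppr_le0 ltW ?std_normal_pdf_gt0.
Qed.

(** For [|w| >= 1] the bound 1 on [|w * stein_sol z w|] suffices; for [|w| < 1] the numerator is at
    most 1 and [phi w >= phi 1]. The constant adds the two cases. *)
Lemma stein_sol_le z w : stein_sol z w <= stein_bound.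
Proof.
have p0 := std_normal_pdf_gt0 w; have [f0 f1 f2] := stein_sol_mul_pdf z w.
have fg0 := stein_sol_ge0 z w.
have p10 : 0 < (phi 1)^-1 by rewrite invr_gt0 std_normal_pdf_gt0.
rewrite /stein_bound; have [w1|w1] := leP 1 `|w|.
  have := normr_mul_stein_sol z w; rewrite normrM (ger0_norm fg0); nra.
suff : stein_sol z w <= (phi 1)^-1 by lra.
have pw : phi 1 <= phi w.
  rewrite !std_normal_pdfE ler_pM2l ?normal_peak_gt0// ler_expR.
  have : w ^+ 2 <= 1 by rewrite -real_normK ?num_real// expr_le1// ltW.
  by rewrite expr1n; lra.
rewrite -[leRHS]mul1r ler_pdivlMr ?std_normal_pdf_gt0//.
have := Phi_le1 w; nra.
Qed.

(** A mean value inequality across the kink at [z]: the interval is split there, and on each side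
    the Stein equation expresses the derivative through [w * stein_sol z w]. *)
Lemma stein_sol_increment z a b m M : a <= b ->
  (forall w, a < w < b -> w < z -> m <= w * stein_sol z w + 1 - Phi z <= M) ->
  (forall w, a < w < b -> z < w -> m <= w * stein_sol z w - Phi z <= M) ->
  m * (b - a) <= stein_sol z b - stein_sol z a <= M * (b - a).
Proof.
move=> ab Hl Hr.
have left c : a <= c -> c <= b -> c <= z ->
    m * (c - a) <= stein_sol z c - stein_sol z a <= M * (c - a).
  move=> ac cb cz; rewrite !stein_sol_leE// ?(le_trans ac)//.
  pose g y := (1 - Phi z) *: (Phi y / phi y).
  apply: (@mean_value_bounds g
    (fun y => (1 - Phi z) * (1 + y * (Phi y / phi y))) a c) => // y.
    by have := is_derive_Phi_div_pdf y => D; apply: is_derive_eq.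
  move=> /andP[ay yc].
  have := Hl y; rewrite ay (lt_le_trans yc cb) (lt_le_trans yc cz).
  rewrite stein_sol_leE ?(ltW (lt_le_trans yc cz))// => /(_ erefl erefl).
  lra.
have right c : a <= c -> c <= b -> z <= c ->
    m * (b - c) <= stein_sol z b - stein_sol z c <= M * (b - c).
  move=> ac cb zc; rewrite !stein_sol_geE// ?(le_trans zc)//.
  pose g y := Phi z *: ((1 - Phi y) / phi y).
  apply: (@mean_value_bounds g
    (fun y => Phi z * (y * ((1 - Phi y) / phi y) - 1)) c b) => // y.
    by have := is_derive_Phic_div_pdf y => D; apply: is_derive_eq.
  move=> /andP[cy yb].
  have := Hr y; rewrite yb (le_lt_trans ac cy) (le_lt_trans zc cy).
  rewrite stein_sol_geE ?(ltW (le_lt_trans zc cy))// => /(_ erefl erefl).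
  lra.
have [bz|zb] := leP b z; first exact: left.
have [za|az] := leP z a; first exact: right.
have := left z (ltW az) (ltW zb) (lexx _); have := right z (ltW az) (ltW zb) (lexx _).
lra.
Qed.

Lemma stein_sol_lipschitz z a b : `|stein_sol z b - stein_sol z a| <= 2 * `|b - a|.
Proof.
wlog ab : a b / a <= b => [H|].
  by have [/H//|/ltW/H] := leP a b; rewrite distrC [`|a - b|]distrC.
rewrite [X in _ * X]ger0_norm ?subr_ge0// ler_norml -mulNr.
by apply: stein_sol_increment => // w _ _; have := normr_mul_stein_sol z w;
  have := Phi_ge0 z; have := Phi_le1 z; rewrite ler_norml; lra.
Qed.

(* The slope is an average of the derivative [x * stein_sol z x + (x <= z) - Phi z]
   over points [x] within [d] of [w]. *)
Lemma stein_sol_slope z d w a b : `|a - w| <= d -> `|b - w| <= d -> a != b ->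
  w * stein_sol z w - d * (stein_bound + 2 * `|w|) + (w <= z - d)%R%:R - Phi z
  <= (stein_sol z b - stein_sol z a) / (b - a)
  <= w * stein_sol z w + d * (stein_bound + 2 * `|w|) + (w <= z + d)%R%:R - Phi z.
Proof.
wlog ab : a b / a < b => [H|aw bw _].
  move=> aw bw; rewrite neq_lt => /orP[|] lt_ab; first by apply: H; rewrite ?lt_eqF.
  have -> : (stein_sol z b - stein_sol z a) / (b - a)
      = (stein_sol z a - stein_sol z b) / (a - b) by rewrite -mulrNN -invrN !opprB.
  by apply: H; rewrite ?lt_eqF.
rewrite ler_pdivlMr ?subr_gt0// ler_pdivrMr ?subr_gt0//.
have K x : a < x < b -> w - d < x < w + d /\
    `|x * stein_sol z x - w * stein_sol z w| <= d * (stein_bound + 2 * `|w|).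
  move=> /andP[ax xb].
  have /andP[a1 a2] : - d <= a - w <= d by rewrite -ler_norml.
  have /andP[b1 b2] : - d <= b - w <= d by rewrite -ler_norml.
  have xwd : `|x - w| <= d by rewrite ler_norml; lra.
  split; first lra.
  have -> : x * stein_sol z x - w * stein_sol z w =
    (x - w) * stein_sol z x + w * (stein_sol z x - stein_sol z w) by ring.
  rewrite [leRHS]mulrDr (le_trans (ler_normD _ _))// !normrM; apply: lerD.
    by rewrite ler_pM// ger0_norm ?stein_sol_ge0// stein_sol_le.
  have := stein_sol_lipschitz z w x; have := normr_ge0 w; nra.
apply: stein_sol_increment => [|x /K[xwd]|x /K[xwd]]; first exact: ltW.
  (* The derivative at [x] carries [(x <= z)]. As [|x - w| < d], [x < z] forces [w <= z + d], and
     [x > z] forces [w > z - d]; this is why the indicators are shifted by [d]. *)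
  rewrite ler_norml => /andP[k1 k2] xz.
  have -> /= : w <= z + d by lra.
  by case: (w <= z - d) => /=; lra.
rewrite ler_norml => /andP[k1 k2] xz.
have /negbTE-> : ~~ (w <= z - d) by rewrite -ltNge; lra.
by case: (w <= z + d) => /=; lra.
Qed.

End Gaussian.

(** * Statistics of uniform permutations *)

Section Combinatorial.
Context {R : realType} {n : nat}.
Variable a : 'I_n -> 'I_n -> R.
Implicit Types (s t : 'S_n) (i j k l : 'I_n) (g : R -> R).

Definition perm_stat s : R := \sum_i a i (s i).

(** The decrease of the statistic when [i] and [j], with images [k] and [l], exchange their
    images. *)
Definition swap_diff i j k l : R := a i k + a j l - a i l - a j k.

Lemma swap_diff_diag1 i k l : swap_diff i i k l = 0.
Proof. by rewrite /swap_diff; ring. Qed.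

Lemma swap_diff_diag2 i j k : swap_diff i j k k = 0.
Proof. by rewrite /swap_diff; ring. Qed.

Lemma perm_stat_tpermM i j s :
  perm_stat s - perm_stat (tperm i j * s)%g = swap_diff i j (s i) (s j).
Proof.
rewrite /perm_stat /swap_diff.
have [->|ij] := eqVneq i j.
  rewrite tperm1 mul1g; ring.
rewrite (bigD1 i)//= (bigD1 j) 1?eq_sym//= [X in _ - X](bigD1 i)//=.
rewrite [X in _ - (_ + X)](bigD1 j) 1?eq_sym//= !permM tpermL tpermR.
rewrite [X in _ - (_ + (_ + X))](eq_bigr (fun k => a k (s k))); last first.
  by move=> k /andP[ki kj]; rewrite permM tpermD// eq_sym.
ring.
Qed.

(** Exchanging the values [k] and [l] amounts to exchanging the images of their preimages, which
    involves only four entries of [a]. *)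
Lemma normr_perm_statM (B : R) k l s : (forall i j, `|a i j| <= B) ->
  `|perm_stat (s * tperm k l)%g - perm_stat s| <= 4 * B.
Proof.
move=> aB; rewrite distrC.
pose i := (s^-1)%g k; pose j := (s^-1)%g l.
have -> : (s * tperm k l)%g = (tperm i j * s)%g.
  by rewrite [RHS]conjgC tpermJ !permKV.
rewrite perm_stat_tpermM /swap_diff.
have := aB i (s i); have := aB j (s j); have := aB i (s j); have := aB j (s i).
rewrite !ler_norml; lra.
Qed.

Hypothesis row0 : forall i, \sum_j a i j = 0.
Hypothesis col0 : forall j, \sum_i a i j = 0.

(** The linear regression property of the exchangeable pair: double centering kills the two cross
    terms. *)
Lemma sum_swap_diff s : \sum_i \sum_j swap_diff i j (s i) (s j) = 2 * n%:R * perm_stat s.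
Proof.
rewrite /swap_diff.
have E1 i : \sum_j (a i (s i) + a j (s j) - a i (s j) - a j (s i))
    = n%:R * a i (s i) + perm_stat s.
  have Er : \sum_j a i (s j) = 0 by rewrite -[RHS](row0 i) [RHS](reindex_perm s).
  by rewrite !sumrB big_split/= sumr_const card_ord col0 mulr_natl Er !subr0.
under eq_bigr do rewrite E1.
rewrite big_split/= -mulr_sumr sumr_const card_ord -mulr_natl -/(perm_stat s).
by ring.
Qed.

(** The total mass of the zero-bias weights. For fixed [i], [j], [swap_diff] is [c k - c l] with [c]
    of sum 0, so the cross terms vanish; the same expansion is then made over [i], [j]. *)
Lemma sum_swap_diff_sqr : \sum_i \sum_j \sum_k \sum_l swap_diff i j k l ^+ 2
  = 4 * n%:R ^+ 2 * \sum_i \sum_j a i j ^+ 2.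
Proof.
have E i j : \sum_k \sum_l swap_diff i j k l ^+ 2
    = 2 * n%:R * \sum_k (a i k - a j k) ^+ 2.
  pose c k := a i k - a j k.
  have c0 : \sum_k c k = 0 by rewrite sumrB !row0 subrr.
  transitivity (\sum_k (n%:R * c k ^+ 2 + \sum_l c l ^+ 2)).
    apply: eq_bigr => k _.
    transitivity (\sum_l (c k ^+ 2 + c l ^+ 2 - 2 * c k * c l)).
      by apply: eq_bigr => l _; rewrite /swap_diff /c; ring.
    rewrite sumrB big_split/= -[X in _ - X]mulr_sumr c0 mulr0 subr0.
    by rewrite sumr_const card_ord mulr_natl.
  rewrite big_split/= -mulr_sumr sumr_const card_ord -mulr_natl; ring.
under eq_bigr => i _ do under eq_bigr => j _ do rewrite E.
under eq_bigr => i _ do rewrite -mulr_sumr.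
rewrite -mulr_sumr.
suff -> : \sum_i \sum_j \sum_k (a i k - a j k) ^+ 2 = 2 * n%:R * \sum_i \sum_j a i j ^+ 2.
  by ring.
rewrite [X in _ = _ * X]exchange_big/= mulr_sumr.
under eq_bigr => i _ do rewrite exchange_big/=.
rewrite exchange_big/=; apply: eq_bigr => k _.
transitivity (\sum_i (n%:R * a i k ^+ 2 + \sum_j a j k ^+ 2)).
  apply: eq_bigr => i _.
  transitivity (\sum_j (a i k ^+ 2 + a j k ^+ 2 - 2 * a i k * a j k)).
    by apply: eq_bigr => j _; ring.
  rewrite sumrB big_split/= -[X in _ - X]mulr_sumr col0 mulr0 subr0.
  by rewrite sumr_const card_ord mulr_natl.
rewrite big_split/= -mulr_sumr sumr_const card_ord -mulr_natl; ring.
Qed.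

(** The change of variable [s |-> tperm i j * s] negates [swap_diff], so both terms of the
    difference contribute equally, and [sum_swap_diff] concludes. *)
Lemma exchangeable_pair_identity g :
  \sum_i \sum_j \sum_(s : 'S_n) swap_diff i j (s i) (s j) *
      (g (perm_stat s) - g (perm_stat (tperm i j * s)%g))
  = 4 * n%:R * \sum_(s : 'S_n) perm_stat s * g (perm_stat s).
Proof.
have E i j : \sum_(s : 'S_n) swap_diff i j (s i) (s j) *
      (g (perm_stat s) - g (perm_stat (tperm i j * s)%g))
    = 2 * \sum_(s : 'S_n) swap_diff i j (s i) (s j) * g (perm_stat s).
  under eq_bigr do rewrite mulrBr.
  rewrite sumrB [X in _ - X](reindex_inj (mulgI (tperm i j)))/=.
  rewrite [X in _ - X](eq_bigr
      (fun s => - (swap_diff i j (s i) (s j) * g (perm_stat s)))).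
    by rewrite sumrN; ring.
  move=> s _; rewrite mulgA tperm2 mul1g !permM tpermL tpermR -mulNr.
  by congr (_ * _); rewrite /swap_diff; ring.
under eq_bigr => i _ do (under eq_bigr => j _ do rewrite E); rewrite -?mulr_sumr.
under eq_bigr => i _ do rewrite -mulr_sumr exchange_big/=.
rewrite -mulr_sumr exchange_big/=.
rewrite !mulr_sumr; apply: eq_bigr => s _.
under eq_bigr do rewrite -mulr_suml.
by rewrite -mulr_suml sum_swap_diff; ring.
Qed.

End Combinatorial.

(** * Permutations conditioned on two prescribed values *)

Section Relabel.
Context {R : realType} {n : nat}.
Implicit Types (s t : 'S_n) (i j k l : 'I_n) (G : 'S_n -> R).

(* If [s] is uniform, [relabel2 i j k l s] is uniform among the permutations
   mapping [i] to [k] and [j] to [l], and it differs from [s] by two transpositions. *)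
Definition relabel1 i k s : 'S_n := (s * tperm (s i) k)%g.
Definition relabel2 i j k l s : 'S_n := relabel1 j l (relabel1 i k s).

Lemma relabel1E i k s : relabel1 i k s i = k.
Proof. by rewrite permM tpermL. Qed.

Lemma relabel2E i j k l s : i != j -> k != l ->
  relabel2 i j k l s i = k /\ relabel2 i j k l s j = l.
Proof.
move=> ij kl; split; last exact: relabel1E.
have kj : relabel1 i k s j != k.
  by rewrite -{2}(relabel1E i k s) (inj_eq perm_inj) eq_sym.
by rewrite permM relabel1E tpermD// eq_sym.
Qed.

(** Right multiplication by [tperm m k] maps the class [s i = m] bijectively onto the class
    [s i = k], and there are [n] values of [m]. *)
Lemma sum_relabel1 i k G :
  \sum_(s : 'S_n) G (relabel1 i k s) = n%:R * \sum_(s : 'S_n | s i == k) G s.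
Proof.
rewrite (partition_big (fun s => s i) xpredT)//=.
rewrite (eq_bigr (fun=> \sum_(s : 'S_n | s i == k) G s)); last first.
  move=> m _; rewrite [RHS](reindex_inj (mulIg (tperm m k)))/=.
  apply: eq_big => [s|s /eqP sim]; last by rewrite /relabel1 sim.
  by rewrite permM -[X in _ = (_ == X)](tpermL m k) (inj_eq perm_inj).
by rewrite sumr_const card_ord mulr_natl.
Qed.

(** As in [sum_relabel1], but [s j] has only [n.-1] possible values [m != k], and [tperm m l] fixes
    [k], preserving the first constraint. *)
Lemma sum_relabel1_in i j k l G : i != j -> k != l ->
  \sum_(s : 'S_n | s i == k) G (relabel1 j l s)
  = n.-1%:R * \sum_(s : 'S_n | (s i == k) && (s j == l)) G s.
Proof.
move=> ij kl.
rewrite (partition_big (fun s : 'S_n => s j) (predC1 k))/=; last first.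
  by move=> s /eqP <-; rewrite (inj_eq perm_inj) eq_sym.
rewrite (eq_bigr (fun=> \sum_(s : 'S_n | (s i == k) && (s j == l)) G s)); last first.
  move=> m mk; rewrite [RHS](reindex_inj (mulIg (tperm m l)))/=.
  apply: eq_big => [s|s /andP[_ /eqP sim]]; last by rewrite /relabel1 sim.
  rewrite !permM -[X in _ = _ && (_ == X)](tpermL m l) (inj_eq perm_inj).
  have kD : tperm m l k = k by rewrite tpermD// eq_sym.
  by rewrite -[X in _ = (_ == X) && _]kD (inj_eq perm_inj).
by rewrite sumr_const cardC1 card_ord mulr_natl.
Qed.

Lemma sum_relabel2 i j k l G : i != j -> k != l ->
  \sum_(s : 'S_n) G (relabel2 i j k l s)
  = n%:R * n.-1%:R * \sum_(s : 'S_n | (s i == k) && (s j == l)) G s.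
Proof.
move=> ij kl.
by rewrite (sum_relabel1 i k (fun s => G (relabel1 j l s))) sum_relabel1_in// mulrA.
Qed.

End Relabel.

Lemma sum_indicator (R : realType) (T : finType) (P : pred T) :
  \sum_(x : T) (P x)%:R = #|[set x | P x]|%:R :> R.
Proof.
by rewrite -sum1_card natr_sum [RHS]big_mkcond/=; apply: eq_bigr => x _;
  rewrite inE; case: (P x).
Qed.

(** * Zero biasing and the Berry-Esseen bound for permutation statistics *)

Section ZeroBias.
Context {R : realType} {n : nat}.
Variable a : 'I_n -> 'I_n -> R.
Hypothesis row0 : forall i, \sum_j a i j = 0.
Hypothesis col0 : forall j, \sum_i a i j = 0.
Implicit Types (s t : 'S_n) (i j k l : 'I_n) (g : R -> R).

(** [exchangeable_pair_identity] is split by the values [k], [l] of [s] at [i], [j], where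
    [swap_diff] is constant. Each class is then parametrized by all permutations through [relabel2],
    which couples it with the original [s] at the price of a factor [n * n.-1]. *)
Lemma zero_bias_identity g :
  \sum_i \sum_j \sum_k \sum_l \sum_(s : 'S_n)
    swap_diff a i j k l * (g (perm_stat a (relabel2 i j k l s))
       - g (perm_stat a (tperm i j * relabel2 i j k l s)%g))
  = 4 * n%:R ^+ 2 * n.-1%:R * \sum_(s : 'S_n) perm_stat a s * g (perm_stat a s).
Proof.
transitivity (n%:R * n.-1%:R *
    (4 * n%:R * \sum_(s : 'S_n) perm_stat a s * g (perm_stat a s))); last by ring.
rewrite -exchangeable_pair_identity// mulr_sumr; apply: eq_bigr => i _.
rewrite mulr_sumr; apply: eq_bigr => j _.
have [<-|ij] := eqVneq i j.
  rewrite [in RHS]big1 ?mulr0; last by move=> s _; rewrite swap_diff_diag1 mul0r.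
  by do 3! (apply: big1 => ? _); rewrite swap_diff_diag1 mul0r.
pose D s := g (perm_stat a s) - g (perm_stat a (tperm i j * s)%g).
rewrite (partition_big (fun s : 'S_n => s i) xpredT)//= mulr_sumr.
apply: eq_bigr => k _.
rewrite (partition_big (fun s : 'S_n => s j) xpredT)//= mulr_sumr.
apply: eq_bigr => l _.
rewrite -mulr_sumr [in RHS](eq_bigr (fun s => swap_diff a i j k l * D s)); last first.
  by move=> s /andP[/eqP -> /eqP ->].
rewrite -mulr_sumr.
have [<-|kl] := eqVneq k l; first by rewrite swap_diff_diag2 !mul0r mulr0.
by rewrite (sum_relabel2 D ij kl) mulrCA.
Qed.

(** At most three transpositions separate these permutations from [s], and each costs [4 * B]. *)
Lemma perm_stat_relabel_dist (B : R) i j k l s : (forall i j, `|a i j| <= B) ->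
  `|perm_stat a (relabel2 i j k l s) - perm_stat a s| <= 12 * B /\
  `|perm_stat a (tperm i j * relabel2 i j k l s)%g - perm_stat a s| <= 12 * B.
Proof.
move=> aB.
have h1 := normr_perm_statM (s i) k s aB.
have h2 := normr_perm_statM (relabel1 i k s j) l (relabel1 i k s) aB.
set u := relabel2 i j k l s.
have h3 := normr_perm_statM (u i) (u j) u aB.
have uE : (tperm i j * u)%g = (u * tperm (u i) (u j))%g by rewrite conjgC tpermJ.
rewrite uE; move: h1 h2 h3; rewrite -/(relabel1 i k s).
rewrite -/(relabel1 j l (relabel1 i k s)) -/(relabel2 i j k l s) -/u.
by rewrite !ler_norml => *; split; lra.
Qed.

(* Zero biasing: the weights [swap_diff i j k l ^+ 2] are proportional to a
   probability under which [perm_stat * g perm_stat] averages like slopes of [g]. *)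
Lemma sum_perm_stat_mul_bounds (B : R) g (L U : R -> R) : (1 < n)%N ->
  (forall i j, `|a i j| <= B) -> \sum_i \sum_j a i j ^+ 2 = n.-1%:R ->
  (forall w x y, `|x - w| <= 12 * B -> `|y - w| <= 12 * B -> x != y ->
    L w <= (g y - g x) / (y - x) <= U w) ->
  \sum_(s : 'S_n) L (perm_stat a s)
  <= \sum_(s : 'S_n) perm_stat a s * g (perm_stat a s)
  <= \sum_(s : 'S_n) U (perm_stat a s).
Proof.
move=> n1 aB sa gLU.
have c0 : 0 < 4 * n%:R ^+ 2 * n.-1%:R :> R.
  by rewrite !mulr_gt0 ?exprn_gt0 ?ltr0n ?(ltnW n1)//; case: n n1 => [|[]].
have termP i j k l s :
    swap_diff a i j k l ^+ 2 * L (perm_stat a s)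
    <= swap_diff a i j k l * (g (perm_stat a (relabel2 i j k l s))
       - g (perm_stat a (tperm i j * relabel2 i j k l s)%g))
    <= swap_diff a i j k l ^+ 2 * U (perm_stat a s).
  set d := swap_diff a i j k l; have [d0|d0] := eqVneq d 0; first by rewrite d0 expr0n !mul0r lexx.
  have ij : i != j by apply: contra_neq d0 => e; rewrite /d e swap_diff_diag1.
  have kl : k != l by apply: contra_neq d0 => e; rewrite /d e swap_diff_diag2.
  have [ui uj] := relabel2E s ij kl.
  have [h1 h2] := perm_stat_relabel_dist i j k l s aB.
  (* The increment of the statistic is [d] itself, so the summand is [d ^+ 2] times a slope of
     [g]. *)
  have dE := perm_stat_tpermM a i j (relabel2 i j k l s).
  rewrite ui uj -/d in dE.
  have ne : perm_stat a (tperm i j * relabel2 i j k l s)%g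
      != perm_stat a (relabel2 i j k l s) by rewrite eq_sym -subr_eq0 dE.
  have /andP[l1 l2] := gLU _ _ _ h2 h1 ne.
  rewrite dE in l1 l2.
  have dd : 0 < d ^+ 2 by rewrite exprn_even_gt0.
  have e z : d * z = d ^+ 2 * (z / d) by field.
  by rewrite e !ler_pM2l// l1.
have sumE (V : R -> R) : \sum_i \sum_j \sum_k \sum_l \sum_(s : 'S_n)
      swap_diff a i j k l ^+ 2 * V (perm_stat a s)
    = 4 * n%:R ^+ 2 * n.-1%:R * \sum_(s : 'S_n) V (perm_stat a s).
  rewrite -sa -sum_swap_diff_sqr// mulr_suml; apply: eq_bigr => i _.
  rewrite mulr_suml; apply: eq_bigr => j _.
  rewrite mulr_suml; apply: eq_bigr => k _.
  rewrite mulr_suml; apply: eq_bigr => l _.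
  by rewrite mulr_sumr.
rewrite -(ler_pM2l c0) -[X in _ && X](ler_pM2l c0) -zero_bias_identity -!sumE.
by apply/andP; split; apply: ler_sum => i _; apply: ler_sum => j _;
  apply: ler_sum => k _; apply: ler_sum => l _; apply: ler_sum => s _;
  have /andP[] := termP i j k l s.
Qed.

(** For [g = id] every slope is 1, so the two zero-bias bounds coincide. *)
Lemma sum_perm_stat_sqr (B : R) : (1 < n)%N ->
  (forall i j, `|a i j| <= B) -> \sum_i \sum_j a i j ^+ 2 = n.-1%:R ->
  \sum_(s : 'S_n) perm_stat a s ^+ 2 = (n`!)%:R.
Proof.
move=> n1 aB sa.
have slope1 (w x y : R) : `|x - w| <= 12 * B -> `|y - w| <= 12 * B -> x != y ->
    1 <= (y - x) / (y - x) <= 1.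
  by move=> _ _ xy; rewrite divff ?lexx// subr_eq0 eq_sym.
have := sum_perm_stat_mul_bounds (g := id) (L := fun=> 1) (U := fun=> 1) n1 aB sa slope1.
rewrite sumr_const card_Sn -eq_le => /eqP ->.
by apply: eq_bigr => s _; rewrite expr2.
Qed.

(** With [g = stein_sol z], the terms [w * stein_sol z w] cancel between the slope bounds and the
    zero-biased sum, leaving [Phi z] against the frequency of [perm_stat a s <= z - d] or
    [z + d]. *)
Theorem combinatorial_berry_esseen (B t : R) : (1 < n)%N -> 
  (forall i j, `|a i j| <= B) -> \sum_i \sum_j a i j ^+ 2 = n.-1%:R ->
  `|#|[set s | perm_stat a s <= t]|%:R / (n`!)%:R - Phi t|
  <= 12 * B * (stein_bound + 3).
Proof.
move=> n1 aB sa.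
have B0 : 0 <= B.
  by apply: le_trans (aB (Ordinal (ltnW n1)) (Ordinal (ltnW n1))).
pose d := 12 * B; have d0 : 0 <= d by rewrite /d; lra.
have f0 : 0 < (n`!)%:R :> R by rewrite ltr0n fact_gt0.
(* The first absolute moment is at most 1, by [2 * |S| <= 1 + S ^+ 2] and unit variance. *)
have sabs : \sum_(s : 'S_n) `|perm_stat a s| <= (n`!)%:R.
  apply: (@le_trans _ _ (\sum_(s : 'S_n) (2^-1 * (1 + perm_stat a s ^+ 2)))).
    apply: ler_sum => s _.
    have := sqr_ge0 (1 - `|perm_stat a s|).
    rewrite -[perm_stat a s ^+ 2]real_normK ?num_real//; nra.
  rewrite -mulr_sumr big_split/= (sum_perm_stat_sqr n1 aB sa) sumr_const card_Sn; lra.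
have sc (x : R) : \sum_(s : 'S_n) x = (n`!)%:R * x.
  by rewrite sumr_const card_Sn mulr_natl.
have main z : #|[set s | perm_stat a s <= z - d]|%:R
      <= (n`!)%:R * (Phi z + d * (stein_bound + 2)) /\
    (n`!)%:R * (Phi z - d * (stein_bound + 2)) <= #|[set s | perm_stat a s <= z + d]|%:R.
  have /andP[] := sum_perm_stat_mul_bounds
    (L := fun w => w * stein_sol z w - d * (stein_bound + 2 * `|w|)
                   + (w <= z - d)%R%:R - Phi z)
    (U := fun w => w * stein_sol z w + d * (stein_bound + 2 * `|w|)
                   + (w <= z + d)%R%:R - Phi z) n1 aB sa
    (fun w x y h1 h2 h3 => stein_sol_slope z h1 h2 h3).
  rewrite !sumrB !big_split/= sumrN -!mulr_sumr !big_split/= -mulr_sumr.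
  rewrite !sum_indicator !sc => h1 h2.
  have dd := ler_wpM2l d0 sabs.
  rewrite /stein_bound; split; lra.
rewrite ler_distl ler_pdivlMr// ler_pdivrMr//.
(* Moving [z] by [d] brings the threshold back to [t]; [Phi] is 1-Lipschitz, so [stein_bound + 2]
   becomes [stein_bound + 3]. *)
have [m1 _] := main (t + d); have [_ m2] := main (t - d).
have td1 : t <= t + d by lra.
have td2 : t - d <= t by lra.
have /andP[_ p1] := Phi_increment td1; have /andP[_ p2] := Phi_increment td2.
rewrite addrK in m1; rewrite subrK in m2.
apply/andP; split.
  by apply: le_trans m2; rewrite mulrC ler_pM2l// -/d; lra.
by apply: (le_trans m1); rewrite [leRHS]mulrC ler_pM2l// -/d; lra.
Qed.

End ZeroBias.

(** * Complete randomization *)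

Section Randomization.
Context {R : realType} {N Q : nat}.
Variables (Nq : 'I_Q -> nat) (Y : 'I_N -> 'I_Q -> R).
Implicit Types (z kappa : assignment N Q) (s : 'S_N) (q : 'I_Q) (i j : 'I_N).

Lemma CR_supportP z : reflect (forall q, #|[set i | z i == q]| = Nq q) (z \in CR_support N Nq).
Proof. by rewrite inE; apply: (iffP forallP) => H q; apply/eqP. Qed.

Lemma count_mem_assignment z q :
  count_mem q [tuple z i | i < N] = #|[set i | z i == q]|.
Proof. by rewrite /= count_map cardsE cardE enumT -size_filter. Qed.

Lemma CR_support_ne0 : (\sum_(q < Q) Nq q)%N = N -> exists kappa, kappa \in CR_support N Nq.
Proof.
move=> sN; pose L := flatten [seq nseq (Nq q) q | q <- enum 'I_Q].
have sL : size L == N.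
  rewrite size_flatten sumnE /shape -map_comp big_map big_enum/= -[X in _ == X]sN.
  by apply/eqP; apply: eq_bigr => q _; rewrite size_nseq.
exists [ffun i => tnth (Tuple sL) i]; apply/CR_supportP => q.
rewrite -count_mem_assignment.
have -> : [tuple [ffun i => tnth (Tuple sL) i] i | i < N] = Tuple sL.
  by apply: eq_from_tnth => i; rewrite tnth_mktuple ffunE.
rewrite count_flatten sumnE -map_comp big_map big_enum/=.
rewrite (bigD1 q)//= count_nseq /= eqxx mul1n big1 ?addn0// => q' q'q.
by rewrite count_nseq /= (negbTE q'q).
Qed.

Definition assign_perm kappa s : assignment N Q := [ffun i => kappa (s i)].

Lemma assign_perm_support kappa s :
  kappa \in CR_support N Nq -> assign_perm kappa s \in CR_support N Nq.
Proof.
move=> /CR_supportP kS; apply/CR_supportP => q; rewrite -kS.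
rewrite -[RHS](card_preimset _ (@perm_inj _ s)).
by apply: eq_card => i; rewrite !inE ffunE.
Qed.

(** Equal group sizes mean that the two tuples of levels are equal as multisets. *)
Lemma assign_perm_surj kappa z : kappa \in CR_support N Nq -> z \in CR_support N Nq ->
  exists s, z = assign_perm kappa s.
Proof.
move=> /CR_supportP kS /CR_supportP zS.
have : perm_eq [tuple z i | i < N] [tuple kappa i | i < N].
  by apply/allP => q _; rewrite /= -!/(count_mem _ _) !count_mem_assignment kS zS.
move=> /tuple_permP[s zs]; exists s; apply/ffunP => i.
have /(congr1 (fun l => tnth l i)) := val_inj zs.
by rewrite !tnth_mktuple ffunE.
Qed.

(** Left translation by [u] identifies the fiber of [assign_perm kappa] over [kappa] with the one
    over [assign_perm kappa u]. All fibers over the support thus have the same size, and the uniform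
    law on permutations is pushed to the uniform law on assignments. *)
Lemma CR_probE kappa (E : assignment N Q -> bool) : kappa \in CR_support N Nq ->
  CR_prob Nq E = #|[set s | E (assign_perm kappa s)]|%:R / (N`!)%:R :> R.
Proof.
move=> kS.
pose c := #|[set s | assign_perm kappa s == kappa]|.
have c0 : (0 < c)%N.
  apply/card_gt0P; exists 1%g; rewrite inE; apply/eqP/ffunP => i.
  by rewrite ffunE perm1.
have fiber z : z \in CR_support N Nq -> #|[set s | assign_perm kappa s == z]| = c.
  move=> /(assign_perm_surj kS)[u ->].
  rewrite -[LHS](card_preimset _ (mulgI u)).
  apply: eq_card => s; rewrite !inE; apply/eqP/eqP => /ffunP e; apply/ffunP => i.
    by have := e ((u^-1)%g i); rewrite !ffunE permM permKV.
  by have := e (u i); rewrite !ffunE permM.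
have count (P : assignment N Q -> bool) : #|[set s | P (assign_perm kappa s)]|
    = (#|[set z in CR_support N Nq | P z]| * c)%N.
  rewrite -sum1_card (partition_big (assign_perm kappa)
    (fun z => z \in [set z in CR_support N Nq | P z]))/=; last first.
    by move=> s; rewrite !inE => ->; have := assign_perm_support s kS; rewrite inE => ->.
  rewrite -sum_nat_const; apply: eq_bigr => z; rewrite inE => /andP[zS Pz].
  rewrite -(fiber z zS) -sum1_card; apply: eq_bigl => s; rewrite !inE.
  by have [->|] := eqVneq (assign_perm kappa s) z; rewrite ?andbF// Pz.
(* The trivial event gives [N! = #|CR_support| * c], so [c] cancels in the quotient. *)
have := count xpredT.
rewrite (_ : [set s : 'S_N | true] = [set: 'S_N]); last by apply/setP => s; rewrite !inE.
rewrite cardsT card_Sn (_ : [set z in _ | true] = CR_support N Nq); last first.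
  by apply/setP => z; rewrite !inE andbT.
move=> ->; rewrite count /CR_prob !natrM -mulf_div divff ?mulr1//.
by rewrite pnatr_eq0 -lt0n.
Qed.

Lemma eq_CR_prob (E E' : assignment N Q -> bool) :
  {in CR_support N Nq, E =1 E'} -> CR_prob Nq E = CR_prob Nq E' :> R.
Proof.
move=> EE; rewrite /CR_prob; congr (_%:R / _); apply: eq_card => z.
have [zS|zS] := boolP (z \in CR_support N Nq); last first.
  by move: zS; rewrite !inE => /negbTE ->.
by have := EE z zS; move: zS; rewrite !inE => -> ->.
Qed.

Hypothesis Nq_gt0 : forall q, (0 < Nq q)%N.
Hypothesis sumNq : (\sum_(q < Q) Nq q)%N = N.

Variable c : 'rV[R]_Q.

Definition scaled_outcome i q : R := c 0 q / (Nq q)%:R * (Y i q - Ybar Y q).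

Let NqN0 q : (Nq q)%:R != 0 :> R.
Proof. by rewrite pnatr_eq0 -lt0n. Qed.

Lemma linear_statE z : z \in CR_support N Nq ->
  (c *m (Yhat Nq Y z - Ybar_vec Y)) 0 0 = \sum_i scaled_outcome i (z i).
Proof.
move=> /CR_supportP zS; rewrite mxE (partition_big z xpredT)//=.
apply: eq_bigr => q _; rewrite !mxE.
have -> : Ybar Y q = (Nq q)%:R^-1 * \sum_(i < N | z i == q) Ybar Y q.
  by rewrite sumr_const -cardsE zS -[Ybar Y q *+ _]mulr_natl mulKf.
rewrite -mulrBr -sumrB mulrA mulr_sumr; apply: eq_bigr => i /eqP zi.
by rewrite /scaled_outcome zi.
Qed.

Lemma sum_assignment kappa (f : 'I_Q -> R) : kappa \in CR_support N Nq ->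
  \sum_j f (kappa j) = \sum_q (Nq q)%:R * f q.
Proof.
move=> /CR_supportP kS; rewrite (partition_big kappa xpredT)//=.
apply: eq_bigr => q _; rewrite (eq_bigr (fun=> f q)); last by move=> j /eqP ->.
by rewrite sumr_const -cardsE kS mulr_natl.
Qed.

Lemma sum_centered q : (0 < N)%N -> \sum_i (Y i q - Ybar Y q) = 0.
Proof.
move=> N0; rewrite sumrB sumr_const card_ord -[Ybar Y q *+ _]mulr_natl mulrA divff.
  by rewrite mul1r subrr.
by rewrite pnatr_eq0 -lt0n.
Qed.

Lemma Scov_mul q q' : (1 < N)%N ->
  N.-1%:R * Scov Y q q' = \sum_i (Y i q - Ybar Y q) * (Y i q' - Ybar Y q').
Proof.
by move=> N1; rewrite /Scov mulVKf// pnatr_eq0; case: (N) N1 => [|[]].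
Qed.

Lemma quad_formE (M : 'M[R]_Q) :
  (c *m M *m c^T) 0 0 = \sum_q \sum_q' c 0 q * c 0 q' * M q q'.
Proof.
rewrite mxE; under eq_bigr => q' _ do rewrite [X in X * _]mxE [c^T _ _]mxE mulr_suml.
rewrite exchange_big/=; apply: eq_bigr => q _; apply: eq_bigr => q' _.
by rewrite mulrAC.
Qed.

Lemma quad_Dmat : (c *m Dmat Nq Y *m c^T) 0 0
  = \sum_q c 0 q ^+ 2 * (Scov Y q q / (Nq q)%:R).
Proof.
rewrite quad_formE; apply: eq_bigr => q _.
rewrite (bigD1 q)//= big1 ?addr0 => [|q' /negbTE qq]; first by rewrite mxE eqxx mul1r.
by rewrite mxE eq_sym qq mul0r mulr0.
Qed.

Lemma quad_V_Yhat : (c *m V_Yhat Nq Y *m c^T) 0 0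
  = \sum_q c 0 q ^+ 2 * (Scov Y q q / (Nq q)%:R)
    - \sum_q \sum_q' c 0 q * c 0 q' * (Scov Y q q' / N%:R).
Proof.
have e (M1 M2 : 'M[R]_1) : (M1 - M2) 0 0 = M1 0 0 - M2 0 0 by rewrite !mxE.
rewrite /V_Yhat mulmxBr mulmxBl e quad_Dmat quad_formE.
by congr (_ - _); apply: eq_bigr => q _; apply: eq_bigr => q' _; rewrite mxE.
Qed.

(** Here [N.-1] is 0 and its inverse is 0 by convention. A unit variance therefore forces
    [1 < N]. *)
Lemma V_Yhat_eq0 : (N <= 1)%N -> V_Yhat Nq Y = 0.
Proof.
move=> N1; have N0 : N.-1 = 0%N by case: (N) N1 => [|[|]].
have S0 q q' : Scov Y q q' = 0 by rewrite /Scov N0 invr0 mul0r.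
by apply/matrixP => q q'; rewrite !mxE !S0 !mul0r mulr0 subrr.
Qed.

(** When column [q] is repeated [Nq q] times, the left side is the sum of squares of the
    row-centered array; the identity matches its normalization with unit variance of the linear
    form. *)
Lemma sum_scaled_outcome_sqr : (1 < N)%N ->
  \sum_i (\sum_q (Nq q)%:R * scaled_outcome i q ^+ 2
     - N%:R^-1 * (\sum_q (Nq q)%:R * scaled_outcome i q) ^+ 2)
  = N.-1%:R * (c *m V_Yhat Nq Y *m c^T) 0 0.
Proof.
move=> N1; rewrite quad_V_Yhat mulrBr sumrB; congr (_ - _).
  rewrite exchange_big mulr_sumr/=; apply: eq_bigr => q _.
  rewrite mulrCA [_ * (_ / _)]mulrA Scov_mul// mulr_suml mulr_sumr.
  apply: eq_bigr => i _; rewrite /scaled_outcome; field.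
  exact: NqN0.
rewrite -mulr_sumr.
transitivity (N%:R^-1 * \sum_i \sum_q \sum_q'
   (c 0 q * (Y i q - Ybar Y q)) * (c 0 q' * (Y i q' - Ybar Y q'))).
  congr (_ * _); apply: eq_bigr => i _.
  rewrite expr2 mulr_suml; apply: eq_bigr => q _.
  rewrite mulr_sumr; apply: eq_bigr => q' _.
  by rewrite /scaled_outcome; field; rewrite !NqN0.
rewrite exchange_big !mulr_sumr/=; apply: eq_bigr => q _.
rewrite exchange_big !mulr_sumr/=; apply: eq_bigr => q' _.
transitivity (N%:R^-1 * (c 0 q * c 0 q' * (N.-1%:R * Scov Y q q'))); last by ring.
rewrite Scov_mul// [in RHS]mulr_sumr; congr (_ * _); apply: eq_bigr => i _; ring.
Qed.

(* Subtracting the row means of the scaled outcomes makes the array doubly centered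
   and at most doubles its sup norm. *)
Theorem CR_berry_esseen (B t : R) : (c *m V_Yhat Nq Y *m c^T) 0 0 = 1 ->
  (forall i q, `|scaled_outcome i q| <= B) ->
  `|CR_prob Nq (fun z => (c *m (Yhat Nq Y z - Ybar_vec Y)) 0 0 <= t) - Phi t|
  <= 24 * B * (stein_bound + 3).
Proof.
move=> cV1 AB.
have N1 : (1 < N)%N.
  rewrite ltnNge; apply/negP => N1; have /eqP := cV1.
  by rewrite V_Yhat_eq0// mulmx0 mul0mx mxE eq_sym oner_eq0.
have N0 : N%:R != 0 :> R by rewrite pnatr_eq0 -lt0n ltnW.
have [kappa kS] := CR_support_ne0 sumNq.
pose r i := N%:R^-1 * \sum_j scaled_outcome i (kappa j).
pose a i j := scaled_outcome i (kappa j) - r i.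
have B0 : 0 <= B by apply: le_trans (AB (Ordinal (ltnW N1)) (kappa (Ordinal (ltnW N1)))).
have row0 i : \sum_j a i j = 0.
  by rewrite sumrB sumr_const card_ord -[r i *+ _]mulr_natl mulVKf// subrr.
have colA q : \sum_i scaled_outcome i q = 0.
  by rewrite -mulr_sumr sum_centered ?mulr0// ltnW.
have sr : \sum_i r i = 0.
  by rewrite -mulr_sumr exchange_big big1 ?mulr0//= => j _; exact: colA.
have col0 j : \sum_i a i j = 0 by rewrite sumrB colA sr subrr.
have rB i : `|r i| <= B.
  rewrite normrM ger0_norm ?invr_ge0// mulrC ler_pdivrMr ?lt0r ?N0//=.
  apply: (le_trans (ler_norm_sum _ _ _)).
  apply: (le_trans (ler_sum _ (fun j _ => AB i (kappa j)))).
  by rewrite sumr_const card_ord mulr_natr.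
have aB i j : `|a i j| <= 2 * B.
  by rewrite (le_trans (ler_normB _ _))// mulr_natl mulr2n lerD.
have sa : \sum_i \sum_j a i j ^+ 2 = N.-1%:R.
  transitivity (N.-1%:R * (c *m V_Yhat Nq Y *m c^T) 0 0); last by rewrite cV1 mulr1.
  rewrite -sum_scaled_outcome_sqr//; apply: eq_bigr => i _.
  rewrite -(sum_assignment (fun q => scaled_outcome i q ^+ 2) kS).
  rewrite -(sum_assignment (scaled_outcome i) kS).
  transitivity (\sum_j (scaled_outcome i (kappa j) ^+ 2
      - 2 * r i * scaled_outcome i (kappa j) + r i ^+ 2)).
    by apply: eq_bigr => j _; rewrite /a; ring.
  rewrite big_split/= sumrB -mulr_sumr sumr_const card_ord -[r i ^+ 2 *+ N]mulr_natl /r.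
  by field.
have /= BE := combinatorial_berry_esseen row0 col0 t N1 aB sa.
rewrite (eq_CR_prob (E' := fun z => \sum_i scaled_outcome i (z i) <= t)); last first.
  by move=> z zS /=; rewrite linear_statE.
rewrite (CR_probE _ kS).
rewrite (_ : 24 * B = 12 * (2 * B)); last by ring.
suff -> : [set s | \sum_i scaled_outcome i (assign_perm kappa s i) <= t]
  = [set s | perm_stat a s <= t] by [].
(* The row means sum to 0, so centering leaves the statistic unchanged. *)
apply/setP => s; rewrite !inE /perm_stat sumrB sr subr0.
by under eq_bigr do rewrite ffunE.
Qed.

End Randomization.

(** * Rayleigh quotients *)

Section RayleighQuotient.
Context {R : realType} {n : nat}.
Implicit Types (A V : 'M[R]_n) (x y : 'cV[R]_n).

Local Notation qf A x := ((x^T *m A *m x) 0 0).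
Local Notation sqnorm x := ((x^T *m x) 0 0).

Lemma sqnormE x : sqnorm x = \sum_i x i 0 ^+ 2.
Proof. by rewrite mxE; apply: eq_bigr => i _; rewrite mxE expr2. Qed.

Lemma sqnorm_ge0 x : 0 <= sqnorm x.
Proof. by rewrite sqnormE sumr_ge0// => i _; rewrite sqr_ge0. Qed.

Lemma sqnorm_gt0 x : x != 0 -> 0 < sqnorm x.
Proof.
move=> x0; rewrite lt0r sqnorm_ge0 andbT; apply: contra_neq x0.
rewrite sqnormE => /eqP; rewrite psumr_eq0; last by move=> i _; rewrite sqr_ge0.
move=> /allP h; apply/matrixP => i j; rewrite ord1 mxE.
by have /implyP/(_ erefl) := h i (mem_index_enum _); rewrite sqrf_eq0 => /eqP.
Qed.

Lemma bilin_form_sym A x y : A^T = A -> (x^T *m A *m y) 0 0 = (y^T *m A *m x) 0 0.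
Proof.
move=> sA; have : (x^T *m A *m y)^T = y^T *m A *m x.
  by rewrite !trmx_mul trmxK sA mulmxA.
by move=> <-; rewrite [RHS]mxE.
Qed.

Lemma quadratic_discriminant (p q r : R) : (forall t, 0 <= p + 2 * t * q + t ^+ 2 * r) ->
  0 <= r -> q ^+ 2 <= p * r.
Proof.
move=> h; rewrite le_eqVlt => /predU1P[r0|r0].
  rewrite -r0 mulr0; have [->|q0] := eqVneq q 0; first by rewrite expr0n.
  (* With [r = 0] the polynomial is affine in [t], and this point gives it the value -1. *)
  have := h (- (p + 1) / (2 * q)); rewrite -r0 mulr0 addr0.
  have -> : p + 2 * (- (p + 1) / (2 * q)) * q = -1 by field.
  by rewrite ler0N1.
have := h (- q / r).
have -> : p + 2 * (- q / r) * q + (- q / r) ^+ 2 * r = (p * r - q ^+ 2) / r.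
  by field; rewrite gt_eqF.
by rewrite pmulr_lge0 ?invr_gt0// subr_ge0.
Qed.

Lemma psd_cauchy_schwarz A x y : A^T = A -> psd A ->
  (x^T *m A *m y) 0 0 ^+ 2 <= qf A x * qf A y.
Proof.
move=> sA pA; apply: quadratic_discriminant (pA y) => t.
have -> : qf A x + 2 * t * (x^T *m A *m y) 0 0 + t ^+ 2 * qf A y = qf A (x + t *: y).
  have e (M1 M2 M3 M4 : 'M[R]_1) : (M1 + t *: M2 + t *: (M3 + t *: M4)) 0 0
    = M1 0 0 + t * M2 0 0 + t * (M3 0 0 + t * M4 0 0) by rewrite !mxE.
  have -> : (x + t *: y)^T = x^T + t *: y^T by rewrite linearD/= linearZ.
  rewrite mulmxDr -[_ *m (t *: y)]scalemxAr !mulmxDl -!scalemxAl e.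
  rewrite (bilin_form_sym y x sA); ring.
exact: pA.
Qed.

Lemma dot_cauchy_schwarz x y : ((x^T *m y) 0 0) ^+ 2 <= sqnorm x * sqnorm y.
Proof.
have := @psd_cauchy_schwarz 1%:M x y (trmx1 _ _); rewrite !mulmx1; apply.
by move=> z; rewrite mulmx1 sqnorm_ge0.
Qed.

Lemma qf_le_sqnorm A : exists2 K : R, 0 < K & forall x, qf A x <= K * sqnorm x.
Proof.
(* The 1 keeps [K] positive even when [A = 0], so that it can be inverted. *)
exists (1 + \sum_i \sum_j `|A i j|).
  by rewrite ltr_pwDl// sumr_ge0// => i _; rewrite sumr_ge0.
move=> x.
have xi i : `|x i 0| ^+ 2 <= sqnorm x.
  rewrite sqnormE (bigD1 i)//= real_normK ?num_real// lerDl sumr_ge0// => j _.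
  exact: sqr_ge0.
apply: (@le_trans _ _ (\sum_i \sum_j `|A i j| * sqnorm x)).
  rewrite mxE; under eq_bigr do rewrite mxE mulr_suml.
  rewrite exchange_big; apply: ler_sum => i _; apply: ler_sum => j _.
  rewrite mxE; apply: (le_trans (ler_norm _)); rewrite !normrM.
  rewrite mulrAC mulrC ler_wpM2l//.
  have := xi i; have := xi j; have := sqr_ge0 (`|x i 0| - `|x j 0|); nra.
under eq_bigr do rewrite -mulr_suml.
rewrite -mulr_suml mulrDl mul1r lerDr sqnorm_ge0//.
Qed.

(* Cauchy-Schwarz for the form of [A], applied to [x] and [A^-1 x]. *)
Lemma psd_unit_coercive A : A^T = A -> psd A -> A \in unitmx ->
  exists2 e : R, 0 < e & forall x, e * sqnorm x <= qf A x.
Proof.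
move=> sA pA uA; have [K K0 hK] := qf_le_sqnorm (invmx A).
exists K^-1; rewrite ?invr_gt0// => x.
have [->|x0] := eqVneq x 0.
  by rewrite !mulmx0 !mxE mulr0.
have := psd_cauchy_schwarz x (invmx A *m x) sA pA.
have -> : x^T *m A *m (invmx A *m x) = x^T *m x.
  by rewrite -mulmxA mulKVmx.
have -> : (invmx A *m x)^T *m A *m (invmx A *m x) = x^T *m invmx A *m x.
  by rewrite -mulmxA mulKVmx// trmx_mul trmx_inv sA.
have := hK x; have := sqnorm_gt0 x0; have := pA x => h1 h2 h3 h4.
rewrite mulrC ler_pdivrMr// -(ler_pM2r h2) -expr2 (le_trans h4)//.
by rewrite -mulrA ler_wpM2l.
Qed.

Lemma qf_shift A (m : R) x : qf (A - m%:M) x = qf A x - m * sqnorm x.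
Proof. by rewrite mulmxBr mulmxBl mul_mx_scalar -scalemxAl !mxE. Qed.

(** Let [m] be the infimum of the Rayleigh quotients. If [V - m%:M] were invertible it would be
    coercive, and [m + e] would still be a lower bound; hence [m] is an eigenvalue. It is the least
    one, since an eigenvalue is the quotient at its eigenvector. *)
Lemma rho_min_rayleigh V : (0 < n)%N -> V^T = V -> posdef V ->
  0 < rho_min V /\ forall x, rho_min V * sqnorm x <= qf V x.
Proof.
move=> n0 sV pV.
pose S := [set r : R | exists2 x : 'cV[R]_n, x != 0 & r = qf V x / sqnorm x]%classic.
have S0 r : S r -> 0 < r by move=> [x x0 ->]; rewrite divr_gt0 ?sqnorm_gt0 ?pV.
have lbS : has_inf S.
  split; last by exists 0 => r /S0 /ltW.
  pose u : 'cV[R]_n := const_mx 1; exists (qf V u / sqnorm u), u => //.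
  apply/eqP => /matrixP/(_ (Ordinal n0) 0); rewrite !mxE => /eqP.
  by rewrite oner_eq0.
set m := inf S.
have mV x : m * sqnorm x <= qf V x.
  have [->|x0] := eqVneq x 0; first by rewrite !mulmx0 !mxE mulr0.
  rewrite -ler_pdivlMr ?sqnorm_gt0//; apply: ge_inf; last by exists x.
  by case: lbS.
have sVm : (V - m%:M)^T = V - m%:M by rewrite linearB/= sV tr_scalar_mx.
have pVm : psd (V - m%:M) by move=> x; rewrite qf_shift subr_ge0.
have sing : V - m%:M \notin unitmx.
  apply/negP => /(psd_unit_coercive sVm pVm)[e e0 he].
  have : m + e <= m.
    apply: lb_le_inf; first by case: lbS.
    move=> r [x x0 ->]; rewrite ler_pdivlMr ?sqnorm_gt0// mulrDl.
    by have := he x; rewrite qf_shift; lra.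
  by rewrite gerDl leNgt e0.
have em : eigenvalue V m.
  rewrite /eigenvalue /eigenspace kermx_eq0 -row_free_unit in sing *.
  exact: sing.
have eS r : eigenvalue V r -> m <= r.
  move=> /eigenvalueP[v vV v0].
  have := mV v^T; rewrite trmxK vV -scalemxAl [X in _ <= X]mxE.
  have v0' : v^T != 0 by rewrite -trmx0 (inj_eq trmx_inj).
  by have := sqnorm_gt0 v0'; rewrite trmxK => h; rewrite ler_pM2r.
have -> : rho_min V = m.
  apply/eqP; rewrite eq_le; apply/andP; split.
    by apply: ge_inf => //; exists m => r /eS.
  by apply: lb_le_inf; [exists m|move=> r /eS].
split=> //.
have /eigenvalueP[v vV v0] := em.
have v0' : v^T != 0 by rewrite -trmx0 (inj_eq trmx_inj).
have := pV _ v0'; rewrite trmxK vV -scalemxAl mxE pmulr_lgt0//.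
by have := sqnorm_gt0 v0'; rewrite trmxK.
Qed.

End RayleighQuotient.

(** * Inverse square roots of the covariance matrix *)

Section InverseSquareRoot.
Context {R : realType} {n : nat}.
Variables W V : 'M[R]_n.
Hypothesis Winv : is_inv_sqrt W V.

Lemma inv_sqrt_conj : W *m V *m W = 1%:M.
Proof. by case: Winv => _ [_]; rewrite -mulmxA => /mulmx1C. Qed.

Lemma inv_sqrt_sym : V^T = V.
Proof.
case: Winv => sW [_ WWV].
have VWW : V^T *m (W *m W) = 1%:M by rewrite -[RHS]trmx1 -WWV !trmx_mul sW.
by rewrite -[LHS]mulmx1 -WWV mulmxA VWW mul1mx.
Qed.

Lemma inv_sqrt_posdef : posdef V.
Proof.
case: (Winv) => sW [_ WWV] y y0.
pose u := W *m V *m y.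
have yE : y = W *m u by rewrite /u !mulmxA WWV mul1mx.
have u0 : u != 0 by apply: contra_neq y0 => u0; rewrite yE u0 mulmx0.
have -> : y^T *m V *m y = u^T *m u; last exact: sqnorm_gt0.
have -> : y^T *m V *m y = u^T *m (W *m V *m W) *m u by rewrite yE trmx_mul sW !mulmxA.
by rewrite inv_sqrt_conj mulmx1.
Qed.

End InverseSquareRoot.

(** * Coefficients of the standardized linear form *)

Section LinearForms.
Context {R : realType} {N Q H : nat}.
Variables (Nq : 'I_Q -> nat) (Y : 'I_N -> 'I_Q -> R).
Variables (F : 'M[R]_(Q, H)) (W : 'M[R]_H) (b : 'cV[R]_H).
Hypothesis Nq_gt0 : forall q, (0 < Nq q)%N.
Hypothesis Winv : is_inv_sqrt W (F^T *m V_Yhat Nq Y *m F).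
Hypothesis b1 : norm2_col b = 1.

Local Notation V := (F^T *m V_Yhat Nq Y *m F).
Local Notation x := (W *m b).
Local Notation c := (b^T *m W *m F^T).

Let NqR_gt0 q : 0 < (Nq q)%:R :> R.
Proof. by rewrite ltr0n. Qed.

Lemma sqnorm_unit : (b^T *m b) 0 0 = 1.
Proof.
rewrite sqnormE; move: b1; rewrite /norm2_col => /(congr1 (fun y => y ^+ 2)).
by rewrite sqr_sqrtr ?expr1n// sumr_ge0// => i _; rewrite sqr_ge0.
Qed.

Lemma unit_dim_gt0 : (0 < H)%N.
Proof.
rewrite lt0n; apply/eqP => H0; have := sqnorm_unit.
rewrite sqnormE big1; first by move=> /esym/eqP; rewrite oner_eq0.
by move=> [i iH]; exfalso; rewrite H0 in iH.
Qed.

Lemma trmx_direction : x^T *m F^T = c.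
Proof. by case: Winv => sW _; rewrite trmx_mul sW. Qed.

Lemma qf_direction : (x^T *m V *m x) 0 0 = 1.
Proof.
rewrite trmx_mul (proj1 Winv) -sqnorm_unit.
have -> : b^T *m W *m V *m (W *m b) = b^T *m (W *m V *m W) *m b by rewrite !mulmxA.
by rewrite (inv_sqrt_conj Winv) mulmx1.
Qed.

Lemma direction_trmx : c^T = F *m x.
Proof. by rewrite -trmx_direction -trmx_mul trmxK. Qed.

Lemma qf_V_Yhat : (c *m V_Yhat Nq Y *m c^T) 0 0 = 1.
Proof. by rewrite direction_trmx -trmx_direction -[RHS]qf_direction !mulmxA. Qed.

Lemma N_gt1 : (1 < N)%N.
Proof.
rewrite ltnNge; apply/negP => N1; have /eqP := qf_V_Yhat.
by rewrite V_Yhat_eq0// mulmx0 mul0mx mxE eq_sym oner_eq0.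
Qed.

Lemma Scov_ge0 q : 0 <= Scov Y q q.
Proof.
by rewrite /Scov mulr_ge0// ?invr_ge0// sumr_ge0// => i _; rewrite -expr2 sqr_ge0.
Qed.

(** For a level of zero variance, the first term of the minimum has denominator 0 and so equals 0;
    the scaled outcome must vanish as well. *)
Lemma Scov_eq0 q i : Scov Y q q = 0 -> Y i q - Ybar Y q = 0.
Proof.
move=> S0; have := Scov_mul Y q q N_gt1; rewrite S0 mulr0 => /esym/eqP.
rewrite psumr_eq0; last by move=> j _; rewrite -expr2 sqr_ge0.
move=> /allP/(_ i (mem_index_enum _))/implyP/(_ erefl).
by rewrite mulf_eq0 orbb => /eqP.
Qed.

(** Condition 1 is evaluated at [W *m b], where the form of [V] is 1; the form of [Dmat] is a sum of
    nonnegative terms, of which the [q]-th is kept. *)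
Lemma direction_coef_le_cond sigma q : 1 <= sigma ->
  loewner_le (F^T *m Dmat Nq Y *m F) (sigma ^+ 2 *: V) ->
  c 0 q ^+ 2 * (Scov Y q q / (Nq q)%:R) <= sigma ^+ 2.
Proof.
move=> s1 /(_ x); rewrite mulmxBr mulmxBl mxE -scalemxAr -scalemxAl [X in X + _]mxE.
rewrite qf_direction mulr1 [X in _ + X]mxE subr_ge0; apply: le_trans.
have -> : x^T *m (F^T *m Dmat Nq Y *m F) *m x = c *m Dmat Nq Y *m c^T.
  by rewrite direction_trmx -trmx_direction !mulmxA.
rewrite quad_Dmat (bigD1 q)//= lerDl sumr_ge0// => p _.
by rewrite mulr_ge0 ?sqr_ge0// divr_ge0 ?Scov_ge0.
Qed.

Lemma direction_coef_le_rho q :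
  `|c 0 q| * Num.sqrt (rho_min V) <= norm2_col (row q F)^T.
Proof.
have [r0 rV] := rho_min_rayleigh unit_dim_gt0
  (inv_sqrt_sym Winv) (inv_sqrt_posdef Winv).
have cE : c 0 q = (row q F *m x) 0 0.
  by rewrite -trmx_direction -trmx_mul [LHS]mxE -row_mul [RHS]mxE.
have := dot_cauchy_schwarz (row q F)^T x; rewrite [X in X *m x]trmxK -cE => CS.
have := rV x; rewrite qf_direction => rx.
rewrite -sqrtr_sqr -sqrtrM ?sqr_ge0// /norm2_col -sqnormE ler_wsqrtr//.
have := sqnorm_ge0 (row q F)^T; nra.
Qed.

Lemma scaled_outcome_le_sup i q : `|scaled_outcome Nq Y c i q|
  <= norminf_row c * \big[Num.max/0]_(q < Q) ((Nq q)%:R^-1 * M_N Y q).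
Proof.
rewrite /scaled_outcome !normrM -mulrA ler_pM ?mulr_ge0//.
  exact: (@le_bigmax _ _ _ 0 (fun j => `|c 0 j|)).
apply: le_trans (@le_bigmax _ _ _ 0 (fun q => (Nq q)%:R^-1 * M_N Y q) q).
rewrite ger0_norm ?invr_ge0// ler_wpM2l ?invr_ge0//.
exact: (@le_bigmax _ _ _ 0 (fun j => `|Y j q - Ybar Y q|)).
Qed.

Lemma scaled_outcome_le_min sigma i q : 1 <= sigma ->
  loewner_le (F^T *m Dmat Nq Y *m F) (sigma ^+ 2 *: V) ->
  `|scaled_outcome Nq Y c i q| <= Num.min
    (sigma * `|Y i q - Ybar Y q| / Num.sqrt ((Nq q)%:R * Scov Y q q))
    (norm2_col (row q F)^T * (Nq q)%:R^-1 * `|Y i q - Ybar Y q|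
      / Num.sqrt (rho_min V)).
Proof.
move=> s1 ls; rewrite le_min /scaled_outcome !normrM [`|_^-1|]ger0_norm ?invr_ge0//.
apply/andP; split.
  have [S0|S0] := eqVneq (Scov Y q q) 0.
    by rewrite (Scov_eq0 i S0) normr0 !mulr0 mul0r.
  have Sp : 0 < Scov Y q q by rewrite lt0r S0 Scov_ge0.
  have NS : 0 < (Nq q)%:R * Scov Y q q by rewrite mulr_gt0.
  (* Without the common factor the claim is [|c_q| * sqrt (N_q * S) <= sigma * N_q], whose square is
     [direction_coef_le_cond] times [N_q ^+ 2]. *)
  rewrite [leRHS]mulrAC ler_wpM2r// ler_pdivlMr ?sqrtr_gt0// mulrAC ler_pdivrMr//.
  rewrite -sqrtr_sqr -sqrtrM ?sqr_ge0//.
  rewrite -[leRHS]ger0_norm ?mulr_ge0 ?(le_trans _ s1)// -sqrtr_sqr ler_wsqrtr//.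
  have := direction_coef_le_cond q s1 ls.
  rewrite mulrA ler_pdivrMr// => h.
  have -> : c 0 q ^+ 2 * ((Nq q)%:R * Scov Y q q)
    = c 0 q ^+ 2 * Scov Y q q * (Nq q)%:R by ring.
  by rewrite exprMn [(Nq q)%:R ^+ 2]expr2 mulrA ler_wpM2r.
have [r0 _] := rho_min_rayleigh unit_dim_gt0
  (inv_sqrt_sym Winv) (inv_sqrt_posdef Winv).
rewrite ler_pdivlMr ?sqrtr_gt0// mulrAC ler_wpM2r// mulrAC ler_wpM2r ?invr_ge0//.
exact: direction_coef_le_rho.
Qed.

End LinearForms.

Theorem theorem1 :
  exists C : Rdefinitions.R, 0 < C /\
  forall (N Q H : nat) (Nq : 'I_Q -> nat)
         (Y : 'I_N -> 'I_Q -> Rdefinitions.R)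
         (F : 'M[Rdefinitions.R]_(Q, H)) (W : 'M[Rdefinitions.R]_H),
    (forall q, (0 < Nq q)%N) ->
    (\sum_(q < Q) Nq q)%N = N ->
    F^T *m V_Yhat Nq Y *m F \in unitmx ->
    is_inv_sqrt W (F^T *m V_Yhat Nq Y *m F) ->
    let gtilde (z : assignment N Q) : 'cV_H :=
        W *m (F^T *m Yhat Nq Y z - F^T *m Ybar_vec Y) in
    (* (i) *)
    (forall b : 'cV[Rdefinitions.R]_H, norm2_col b = 1 ->
      forall t : Rdefinitions.R,
        `| CR_prob Nq (fun z => (b^T *m gtilde z) 0 0 <= t) - Phi t |
        <= C * norminf_row (b^T *m W *m F^T)
             * \big[Num.max/0]_(q < Q) ((Nq q)%:R^-1 * M_N Y q))
    /\
    (* (ii) *)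
    (forall sigma : Rdefinitions.R, 1 <= sigma ->
      loewner_le (F^T *m Dmat Nq Y *m F) (sigma ^+ 2 *: (F^T *m V_Yhat Nq Y *m F)) ->
      forall b : 'cV[Rdefinitions.R]_H, norm2_col b = 1 ->
      forall t : Rdefinitions.R,
        `| CR_prob Nq (fun z => (b^T *m gtilde z) 0 0 <= t) - Phi t |
        <= C * \big[Num.max/0]_(i < N) \big[Num.max/0]_(q < Q)
             Num.min
               (sigma * `|Y i q - Ybar Y q| / Num.sqrt ((Nq q)%:R * Scov Y q q))
               (norm2_col (row q F)^T * (Nq q)%:R^-1 * `|Y i q - Ybar Y q|
                  / Num.sqrt (rho_min (F^T *m V_Yhat Nq Y *m F)))).
Proof.
(* The factor 24 is the coupling distance 12, doubled by the row centering. *)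
exists (24 * (stein_bound + 3)); split.
  by have := @stein_bound_ge0 Rdefinitions.R; lra.
move=> N Q H Nq Y F W Nq0 sNq _ Winv gtilde.
have BE (b : 'cV[Rdefinitions.R]_H) (B t : Rdefinitions.R) : norm2_col b = 1 ->
    (forall i q, `|scaled_outcome Nq Y (b^T *m W *m F^T) i q| <= B) ->
    `| CR_prob Nq (fun z => (b^T *m gtilde z) 0 0 <= t) - Phi t |
    <= 24 * (stein_bound + 3) * B.
  move=> b1 AB; rewrite mulrAC.
  have -> : (fun z => (b^T *m gtilde z) 0 0 <= t)
    = (fun z => (b^T *m W *m F^T *m (Yhat Nq Y z - Ybar_vec Y)) 0 0 <= t).
    by apply/funext => z; rewrite /gtilde -mulmxBr !mulmxA.
  exact: CR_berry_esseen (qf_V_Yhat Winv b1) AB.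
split=> [b b1 t|sigma s1 ls b b1 t].
  by rewrite -mulrA; apply: BE => // i q; exact: scaled_outcome_le_sup.
apply: BE => // i q.
apply: (le_trans (scaled_outcome_le_min Nq0 Winv b1 i q s1 ls)).
pose f i q := Num.min
  (sigma * `|Y i q - Ybar Y q| / Num.sqrt ((Nq q)%:R * Scov Y q q))
  (norm2_col (row q F)^T * (Nq q)%:R^-1 * `|Y i q - Ybar Y q|
     / Num.sqrt (rho_min (F^T *m V_Yhat Nq Y *m F))).
apply: le_trans (le_bigmax 0 (fun i => \big[Num.max/0]_q f i q) i).
exact: (le_bigmax 0 (f i) q).
Qed.
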